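(* Let $p\in[2,\infty)$ and $\varepsilon>0$. There exists a constant $C(p,\varepsilon)$, depending only on $p$ and $\varepsilon$, such that for every positive integer $n$, every $d\in[n]$, every $f\in\mathrm{Deg}_{\le d}$ and every $t>0$, $$\|e^{-t\Delta}f\|_{L^{p+\varepsilon}(\{-1,1\}^n)}\ge \exp(-C(p,\varepsilon)\,td)\,\|f\|_{L^p(\{-1,1\}^n)}.$$ Moreover, $C(p,\varepsilon)$ can be taken to be the same constant as in the Bernstein--Markov type inequality $$\|\Delta^k f\|_{L^p(\{-1,1\}^n)}\le C(p,\varepsilon)^k\,d^k\,\|f\|_{L^{p+\varepsilon}(\{-1,1\}^n)},$$ i.e. any constant depending only on $p$ and $\varepsilon$ for which this inequality holds for all positive integers $n$, all $d\in[n]$, all $f\in\mathrm{Deg}_{\le d}$ and all $k\in\mathbb{N}$ (such a constant exists).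
   Context: Write $[n]=\{1,\dots,n\}$. The Hamming cube $\{-1,1\}^n$ carries the uniform probability measure, and for $p\in[1,\infty)$ and $f\colon\{-1,1\}^n\to\mathbb{C}$, $\|f\|_{L^p(\{-1,1\}^n)}=\left(2^{-n}\sum_{\delta\in\{-1,1\}^n}|f(\delta)|^p\right)^{1/p}$. For $S\subseteq[n]$ the Walsh function is $w_S(\delta)=\prod_{j\in S}\delta_j$, and each $f\colon\{-1,1\}^n\to\mathbb{C}$ has the Fourier--Walsh expansion $f=\sum_{S\subseteq[n]}\widehat f(S)w_S$ with $\widehat f(S)=2^{-n}\sum_{\delta}f(\delta)w_S(\delta)$. $\mathrm{Deg}_{\le d}$ is the space of functions $f\colon\{-1,1\}^n\to\mathbb{C}$ with $\widehat f(S)=0$ whenever $|S|>d$. The Hamming cube Laplacian is $\Delta f=\sum_{j=1}^n\partial_j f$, where $\partial_j f(\delta)=\frac{f(\delta_1,\dots,\delta_j,\dots,\delta_n)-f(\delta_1,\dots,-\delta_j,\dots,\delta_n)}{2}$; equivalently $\Delta f=\sum_{S\subseteq[n]}|S|\,\widehat f(S)\,w_S$. The heat semigroup is $e^{-t\Delta}f=\sum_{S\subseteq[n]}e^{-t|S|}\,\widehat f(S)\,w_S$. *)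

(* Defs.v *)
From mathcomp Require Import all_boot all_order all_algebra.
From mathcomp Require Import reals sequences exp.
From mathcomp Require Import complex.

Set Implicit Arguments.
Unset Strict Implicit.
Unset Printing Implicit Defensive.

Import Order.TTheory GRing.Theory Num.Theory.
Local Open Scope ring_scope.
Local Open Scope complex_scope.

(* A point of {-1,1}^n is encoded by the booleans b_j with
   delta_j = (-1)^(b_j): false stands for 1 and true for -1. *)
Definition cube (n : nat) := {ffun 'I_n -> bool}.

Section HammingCube.
Variables (R : realType) (n : nat).
Implicit Types (f : {ffun cube n -> R[i]}) (delta : cube n) (S : {set 'I_n}).

Definition coord delta (j : 'I_n) : R[i] := (-1) ^+ delta j.

Definition flip (j : 'I_n) delta : cube n :=
  [ffun i => if i == j then ~~ delta i else delta i].

Definition walsh S delta : R[i] := \prod_(j in S) coord delta j.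

Definition fourier_walsh f S : R[i] :=
  (2 ^+ n)^-1 * \sum_(delta : cube n) f delta * walsh S delta.

Definition Deg_le (d : nat) f : Prop :=
  forall S, (d < #|S|)%N -> fourier_walsh f S = 0.

Definition partial (j : 'I_n) f : {ffun cube n -> R[i]} :=
  [ffun delta => (f delta - f (flip j delta)) / 2].

Definition laplacian f : {ffun cube n -> R[i]} := \sum_(j < n) partial j f.

Definition heat (t : R) f : {ffun cube n -> R[i]} :=
  [ffun delta => \sum_(S : {set 'I_n})
     (expR (- t * #|S|%:R))%:C * fourier_walsh f S * walsh S delta].

(* Normc.normc is the R-valued modulus; the norm `|z| of R[i] is R[i]-valued. *)
Definition Lp_norm (p : R) f : R :=
  ((2 ^+ n)^-1 * \sum_(delta : cube n) Normc.normc (f delta) `^ p) `^ p^-1.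

End HammingCube.

Definition bernstein_markov_constant (R : realType) (p eps C : R) : Prop :=
  forall (n d : nat) (f : {ffun cube n -> R[i]}) (k : nat),
    (0 < n)%N -> (1 <= d <= n)%N -> Deg_le d f ->
    Lp_norm p (iter k (@laplacian R n) f)
      <= C ^+ k * d%:R ^+ k * Lp_norm (p + eps) f.

Definition heat_lower_constant (R : realType) (p eps C : R) : Prop :=
  forall (n d : nat) (f : {ffun cube n -> R[i]}) (t : R),
    (0 < n)%N -> (1 <= d <= n)%N -> Deg_le d f -> 0 < t ->
    Lp_norm (p + eps) (heat t f) >= expR (- C * t * d%:R) * Lp_norm p f.

(* Main.v *)
(* Let q = p + eps, h = eta / d and u = 1 - e^{-h Delta}, acting on functions f
   of degree at most d. Since e^{-h Delta} is a contraction of L^q, u^m has norm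
   at most 2^m on L^q, while on L^2 the eigenvalues 1 - e^{-h|S|} <= hd of u give
   norm at most eta^m. As 2 <= p < q, interpolating gives
   ||u^m f||_p <= (eta^theta 2^(1-theta))^m ||f||_q <= 2^-m ||f||_q,
   with theta > 0 depending only on p and eps, once eta = eta(p, eps) is small. The expansion
   h Delta = -log (1 - u) = sum_{j >= 1} u^j / j
   then yields ||Delta^k f||_p <= h^-k ||f||_q, i.e. C = 1/eta. The heat bound
   follows by applying this inequality to each term of the expansion
   f = e^{t Delta} g = sum_k t^k/k! Delta^k g, where g = e^{-t Delta} f. *)
Require Import Defs.
From mathcomp Require Import all_boot all_order all_algebra.
From mathcomp Require Import reals sequences exp.
From mathcomp Require Import complex.
From mathcomp Require Import boolp classical_sets functions interval_inference.
From mathcomp Require Import topology normedtype derive realfun convex hoelder.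
From mathcomp Require Import ring lra.

Set Implicit Arguments.
Unset Strict Implicit.
Unset Printing Implicit Defensive.

Import Order.TTheory GRing.Theory Num.Theory.
Import numFieldNormedType.Exports.
Local Open Scope classical_set_scope.
Local Open Scope ring_scope.
Local Open Scope complex_scope.

(** * Walsh expansions *)

Lemma flipK n (j : 'I_n) : involutive (flip j).
Proof.
move=> delta; apply/ffunP => i; rewrite /flip !ffunE.
by case: eqP => // _; rewrite negbK.
Qed.

Lemma sum_flip n (V : nmodType) (j : 'I_n) (F : cube n -> V) :
  \sum_delta F (flip j delta) = \sum_delta F delta.
Proof. by rewrite [RHS](reindex_inj (inv_inj (flipK j))). Qed.

Lemma card_cube n : #|{: cube n}| = (2 ^ n)%N.
Proof. by rewrite card_ffun card_bool card_ord. Qed.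

Section Walsh.
Variables (R : realType) (n : nat).
Implicit Types (f : {ffun cube n -> R[i]}) (delta : cube n) (S T : {set 'I_n}).

(** Functions are handled through their coefficient families, so that the Laplacian, the heat
    semigroup and their polynomials all become pointwise multiplication of [c]. *)
Definition walsh_sum (c : {set 'I_n} -> R[i]) : {ffun cube n -> R[i]} :=
  [ffun delta => \sum_(S : {set 'I_n}) c S * walsh R S delta].

Lemma walsh_flip S j delta :
  walsh R S (flip j delta) = (-1) ^+ (j \in S) * walsh R S delta.
Proof.
rewrite /walsh; case: (boolP (j \in S)) => jS.
  rewrite (bigD1 j) //= [in RHS](bigD1 j) //= /Defs.coord /flip ffunE eqxx.
  rewrite mulrA; congr (_ * _).
    by case: (delta j); rewrite /= ?expr0 ?expr1 ?mulrNN ?mulr1.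
  by apply: eq_bigr => i /andP[_ /negbTE ij]; rewrite /flip ffunE ij.
rewrite expr0 mul1r; apply: eq_bigr => i iS; rewrite /Defs.coord /flip ffunE.
by case: eqP => // ij; rewrite -ij iS in jS.
Qed.

Lemma normc_walsh S delta : Normc.normc (walsh R S delta) = 1.
Proof.
apply: (big_ind (fun z : R[i] => Normc.normc z = 1)) => [|x y hx hy|j _].
- exact: Normc.normc1.
- by rewrite Normc.normcM hx hy mulr1.
- by rewrite /Defs.coord; case: (delta j); rewrite ?expr0 ?expr1 ?normcN Normc.normc1.
Qed.

(** For [S] different from [T], flipping a coordinate [j] that lies in exactly one of them negates
    each summand, so the sum equals its own negative. *)
Lemma walsh_orthogonal S T :
  \sum_delta walsh R S delta * walsh R T delta = if S == T then 2 ^+ n else 0.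
Proof.
case: eqP => [<-|/eqP neqST].
  rewrite (eq_bigr (fun=> 1)) => [|delta _].
    by rewrite sumr_const card_cube natrX.
  rewrite /walsh -big_split big1 //= => j _.
  by rewrite /Defs.coord -expr2 sqrr_sign.
have [j jST] : exists j, (j \in S) != (j \in T).
  apply/existsP; apply: contraNT neqST; rewrite negb_exists => /forallP h.
  by apply/eqP/setP => j; apply/eqP; rewrite -[_ == _]negbK.
apply/eqP; set x := \sum_delta _.
suff /eqP : x + x = 0 by rewrite -mulr2n mulrn_eq0.
rewrite -[X in X + _](sum_flip j).
rewrite -big_split big1 //= => delta _; rewrite !walsh_flip.
by case: (j \in S) (j \in T) jST => [] [] //= _;
  rewrite ?expr0 ?expr1 ?mul1r ?mulN1r ?mulNr ?mulrN ?addNr ?subrr.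
Qed.

Lemma fourier_walsh_sum (c : {set 'I_n} -> R[i]) S :
  fourier_walsh (walsh_sum c) S = c S.
Proof.
rewrite /fourier_walsh.
under eq_bigr do rewrite ffunE mulr_suml.
rewrite exchange_big /= (bigD1 S) //= [X in _ + X]big1 => [|T neqTS].
  under eq_bigr do rewrite -mulrA.
  by rewrite -mulr_sumr walsh_orthogonal eqxx addr0 mulrCA mulVf ?mulr1.
under eq_bigr do rewrite -mulrA.
by rewrite -mulr_sumr walsh_orthogonal (negbTE neqTS) mulr0.
Qed.

(** The sum over subsets factors as the product over [j] of 1 + delta_j epsilon_j, and this factor
    vanishes wherever the two points differ. *)
Lemma walsh_dual_orthogonal delta epsilon :
  \sum_S walsh R S delta * walsh R S epsilon
  = if delta == epsilon then 2 ^+ n else 0.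
Proof.
have -> : \sum_S walsh R S delta * walsh R S epsilon
    = \prod_j (1 + Defs.coord R delta j * Defs.coord R epsilon j).
  rewrite (eq_bigr (fun j => \sum_(b : bool)
    if b then Defs.coord R delta j * Defs.coord R epsilon j else 1)); last first.
    by move=> j _; rewrite big_bool addrC.
  rewrite bigA_distr_bigA /=.
  (* Expanding the product picks one summand per coordinate; such a choice is a boolean function,
     identified here with the subset where it is true. *)
  rewrite (reindex (fun S : {set 'I_n} => [ffun j => j \in S])) /=.
    apply: eq_bigr => S _; rewrite /walsh -big_split /= big_mkcond /=.
    by apply: eq_bigr => j _; rewrite ffunE.
  exists (fun g : {ffun 'I_n -> bool} => finset g) => x _.
    by apply/setP => j; rewrite inE ffunE.
  by apply/ffunP => j; rewrite ffunE inE.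
case: eqP => [<-|/eqP neq].
  rewrite (eq_bigr (fun=> 2)) ?prodr_const ?card_ord // => j _.
  by rewrite /Defs.coord -expr2 sqrr_sign.
have [j /negP hj] : exists j, delta j != epsilon j.
  apply/existsP; apply: contraNT neq; rewrite negb_exists => /forallP h.
  by apply/eqP/ffunP => j; apply/eqP; rewrite -[_ == _]negbK.
rewrite (bigD1 j) //= /Defs.coord.
by case: (delta j) (epsilon j) hj => [] [] // _;
  rewrite expr0 expr1 ?mulr1 ?mul1r subrr mul0r.
Qed.

Lemma walsh_inversion f : walsh_sum (fourier_walsh f) = f.
Proof.
apply/ffunP => delta; rewrite ffunE /fourier_walsh.
under eq_bigr do rewrite -mulrA mulr_suml.
rewrite -mulr_sumr exchange_big /= (bigD1 delta) //= [X in _ + X]big1.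
  under eq_bigr do rewrite -mulrA.
  by rewrite -mulr_sumr walsh_dual_orthogonal eqxx addr0 mulrCA mulVf ?mulr1.
move=> epsilon neq; under eq_bigr do rewrite -mulrA.
by rewrite -mulr_sumr walsh_dual_orthogonal (negbTE neq) mulr0.
Qed.

Lemma heatE (t : R) f : heat t f =
  walsh_sum (fun S => (expR (- t * #|S|%:R))%:C * fourier_walsh f S).
Proof. by apply/ffunP => delta; rewrite !ffunE. Qed.

Lemma laplacian_walsh_sum (c : {set 'I_n} -> R[i]) :
  laplacian (walsh_sum c) = walsh_sum (fun S => #|S|%:R%:C * c S).
Proof.
apply/ffunP => delta; rewrite /laplacian sum_ffunE ffunE.
under eq_bigr => j _.
  rewrite !ffunE -sumrB mulr_suml.
  under eq_bigr => S _ do rewrite walsh_flip.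
  over.
rewrite exchange_big /=; apply: eq_bigr => S _.
(* Each partial derivative fixes w_S when [j] is in [S] and kills it otherwise, so summing over [j]
   counts the elements of [S]. *)
rewrite (eq_bigr (fun j => if j \in S then c S * walsh R S delta else 0)).
  by rewrite -big_mkcond sumr_const rmorph_nat -mulrA mulr_natl.
move=> j _; case: (j \in S); last by rewrite expr0 mul1r subrr mul0r.
by rewrite expr1 mulN1r mulrN opprK -mulr2n -[X in X / _]mulr_natr mulfK // pnatr_eq0.
Qed.

Lemma iter_laplacian_walsh_sum k (c : {set 'I_n} -> R[i]) :
  iter k (@laplacian R n) (walsh_sum c)
  = walsh_sum (fun S => (#|S|%:R ^+ k)%:C * c S).
Proof.
elim: k => [|k IH].
  by apply/ffunP => delta; rewrite !ffunE; under [RHS]eq_bigr do rewrite expr0 mul1r.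
rewrite iterS IH laplacian_walsh_sum; apply/ffunP => delta; rewrite !ffunE.
by apply: eq_bigr => S _; rewrite mulrA -rmorphM /= -exprS.
Qed.

End Walsh.

(** * L^p norms on the cube *)

Section PowerMeans.
Variable R : realType.

(** Young's inequality with the conjugate exponents 1/a and 1/(1 - a), applied to x^a and y^(1 -
    a). *)
Lemma powR_amgm (x y a : R) : 0 <= x -> 0 <= y -> 0 < a < 1 ->
  x `^ a * y `^ (1 - a) <= a * x + (1 - a) * y.
Proof.
move=> x0 y0 /andP[a0 a1]; have b0 : 0 < 1 - a by rewrite subr_gt0.
have := @conjugate_powR R (x `^ a) (y `^ (1 - a)) a^-1 (1 - a)^-1.
rewrite !invrK -!powRrM !divff ?gt_eqF // !powRr1 // !powR_ge0 !invr_gt0 a0 b0.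
by rewrite addrC subrK (mulrC x) (mulrC y); exact.
Qed.

Lemma powR_convex (p x y t : R) : 1 <= p -> 0 <= x -> 0 <= y -> 0 <= t <= 1 ->
  (t * x + (1 - t) * y) `^ p <= t * x `^ p + (1 - t) * y `^ p.
Proof.
move=> p1 x0 y0 /andP[t0 t1].
have := @convex_powR R p p1 (Itv01 t0 t1) x y.
by rewrite !convRE /=; apply; rewrite inE /= in_itv /= andbT.
Qed.

End PowerMeans.

(** * Means over the cube and Hölder's inequality *)

Section CubeMean.
Variables (R : realType) (n : nat).
Implicit Types (F G : cube n -> R) (a : R).

Definition cube_mean F : R := (2 ^+ n)^-1 * \sum_delta F delta.

Lemma cube_mean_cst a : cube_mean (fun=> a) = a.
Proof.
rewrite /cube_mean sumr_const card_cube -(mulr_natl a) natrX.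
by rewrite mulrA mulVf ?mul1r // expf_neq0 // pnatr_eq0.
Qed.

Lemma eq_cube_mean F G : F =1 G -> cube_mean F = cube_mean G.
Proof. by move=> FG; congr (_ * _); apply: eq_bigr => delta _. Qed.

Lemma cube_mean_le F G : (forall delta, F delta <= G delta) ->
  cube_mean F <= cube_mean G.
Proof.
by move=> FG; apply: ler_wpM2l; [rewrite invr_ge0 exprn_ge0|exact: ler_sum].
Qed.

Lemma cube_mean_ge0 F : (forall delta, 0 <= F delta) -> 0 <= cube_mean F.
Proof. by move=> F0; rewrite -(cube_mean_cst 0) cube_mean_le. Qed.

Lemma cube_meanD F G :
  cube_mean (fun delta => F delta + G delta) = cube_mean F + cube_mean G.
Proof. by rewrite /cube_mean big_split mulrDr. Qed.

Lemma cube_meanZ a F : cube_mean (fun delta => a * F delta) = a * cube_mean F.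
Proof. by rewrite /cube_mean -mulr_sumr mulrCA. Qed.

Lemma cube_mean_eq0 F : (forall delta, 0 <= F delta) -> cube_mean F = 0 ->
  forall delta, F delta = 0.
Proof.
move=> F0 /eqP; rewrite mulf_eq0 invr_eq0 expf_eq0 pnatr_eq0 andbF /=.
by rewrite psumr_eq0 // => /allP h delta; apply/eqP/h; rewrite mem_index_enum.
Qed.

Lemma cube_mean_flip j F : cube_mean (fun delta => F (flip j delta)) = cube_mean F.
Proof. by rewrite /cube_mean (sum_flip). Qed.

(** After dividing [F] and [G] by their means, pointwise weighted AM-GM bounds the integrand by a
    function of mean a + (1 - a) = 1. The endpoints [a = 0], [a = 1] and vanishing means are treated
    first; a nonnegative function of mean 0 is identically 0. *)
Lemma cube_mean_holder F G a :
  (forall delta, 0 <= F delta) -> (forall delta, 0 <= G delta) -> 0 <= a <= 1 ->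
  cube_mean (fun delta => F delta `^ a * G delta `^ (1 - a))
    <= cube_mean F `^ a * cube_mean G `^ (1 - a).
Proof.
move=> F0 G0; have mF0 := cube_mean_ge0 F0; have mG0 := cube_mean_ge0 G0.
rewrite le_eqVlt => /andP[/predU1P[<- _|a0]].
  rewrite subr0 powRr0 powRr1 // mul1r (@eq_cube_mean _ G) // => delta.
  by rewrite powRr0 powRr1 // mul1r.
rewrite le_eqVlt => /predU1P[->|a1].
  rewrite subrr powRr0 powRr1 // mulr1 (@eq_cube_mean _ F) // => delta.
  by rewrite powRr0 powRr1 // mulr1.
have [mF|mF] := eqVneq (cube_mean F) 0.
  rewrite (@eq_cube_mean _ (fun=> 0)) ?cube_mean_cst ?mulr_ge0 ?powR_ge0 // => delta.
  by rewrite (cube_mean_eq0 F0 mF) powR0 ?mul0r // gt_eqF.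
have [mG|mG] := eqVneq (cube_mean G) 0.
  rewrite (@eq_cube_mean _ (fun=> 0)) ?cube_mean_cst ?mulr_ge0 ?powR_ge0 // => delta.
  by rewrite (cube_mean_eq0 G0 mG) powR0 ?mulr0 // subr_eq0 gt_eqF.
set A := cube_mean F in mF mF0 *; set B := cube_mean G in mG mG0 *.
rewrite (@eq_cube_mean _ (fun delta =>
    (A `^ a * B `^ (1 - a)) * ((F delta / A) `^ a * (G delta / B) `^ (1 - a)))).
  rewrite cube_meanZ ler_piMr ?mulr_ge0 ?powR_ge0 //.
  apply: le_trans (cube_mean_le (G := fun delta =>
    (a / A) * F delta + ((1 - a) / B) * G delta) _) _.
    move=> delta; rewrite -!mulrA ![_^-1 * _]mulrC.
    by apply: powR_amgm; rewrite ?divr_ge0 // a0.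
  rewrite cube_meanD !cube_meanZ -/A -/B !divfK //.
  by rewrite addrC subrK.
move=> delta; rewrite mulrACA -!powRM ?divr_ge0 //.
by rewrite ![_ * (_ / _)]mulrC !divfK.
Qed.

End CubeMean.

(** * Monotonicity, interpolation and the triangle inequality for L^p norms *)

Section LpNorm.
Variables (R : realType) (n : nat).
Implicit Types (f g : {ffun cube n -> R[i]}) (p q r a b : R).
Local Notation normc := Normc.normc.

Lemma normc_ge0 (z : R[i]) : 0 <= normc z.
Proof. by case: z => x y; exact: sqrtr_ge0. Qed.

Lemma normc_real (x : R) : normc x%:C = `|x|.
Proof. by rewrite /normc /= expr0n addr0 sqrtr_sqr. Qed.

Lemma normc_sqr (z : R[i]) : (normc z ^+ 2)%:C = z * Num.conj z.
Proof.
rewrite -sqr_normc -add_Re2_Im2; case: z => x y /=.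
by rewrite /Normc.normc sqr_sqrtr // addr_ge0 ?sqr_ge0.
Qed.

Lemma Lp_normE p f :
  Lp_norm p f = cube_mean (fun delta => normc (f delta) `^ p) `^ p^-1.
Proof. by []. Qed.

Lemma Lp_norm_ge0 p f : 0 <= Lp_norm p f.
Proof. exact: powR_ge0. Qed.

#[local] Opaque Lp_norm powR Normc.normc.

Lemma mean_powR_ge0 p f : 0 <= cube_mean (fun delta => normc (f delta) `^ p).
Proof. by apply: cube_mean_ge0 => delta; exact: powR_ge0. Qed.

Lemma Lp_norm_powR p f : 0 < p ->
  Lp_norm p f `^ p = cube_mean (fun delta => normc (f delta) `^ p).
Proof.
by move=> p0; rewrite Lp_normE -powRrM mulVf ?gt_eqF // powRr1 // mean_powR_ge0.
Qed.

Lemma Lp_norm_leP p f a : 0 < p -> 0 <= a ->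
  cube_mean (fun delta => normc (f delta) `^ p) <= a `^ p -> Lp_norm p f <= a.
Proof.
move=> p0 a0 h; rewrite Lp_normE -[leRHS](powRr1 a0) -(mulfV (lt0r_neq0 p0)) powRrM.
by apply: ge0_ler_powR; rewrite ?nnegrE ?invr_ge0 ?(ltW p0) ?powR_ge0 ?mean_powR_ge0.
Qed.

Lemma Lp_norm_mono p q f : 0 < p <= q -> Lp_norm p f <= Lp_norm q f.
Proof.
move=> /andP[p0 pq]; have q0 := lt_le_trans p0 pq.
apply: Lp_norm_leP => //; first exact: Lp_norm_ge0.
rewrite Lp_normE -powRrM mulrC.
(* Hölder against the constant 1 with weight p/q, since |f|^p is the power p/q of |f|^q. *)
have := @cube_mean_holder R n (fun delta => normc (f delta) `^ q) (fun=> 1) (p / q).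
rewrite cube_mean_cst !powR1 mulr1.
rewrite (@eq_cube_mean _ _ _ (fun delta => normc (f delta) `^ p)); last first.
  by move=> delta; rewrite mulr1 -powRrM mulrCA mulfV ?mulr1 // gt_eqF.
apply=> [delta|//|]; first exact: powR_ge0.
by rewrite divr_ge0 ?(ltW p0) ?(ltW q0) //= ler_pdivrMr // mul1r.
Qed.

(** Hölder applied to |f|^r = (|f|^p)^a (|f|^q)^(1 - a). Taking r-th roots turns the weights [a] and
    [1 - a] into a p / r and (1 - a) q / r, which again sum to 1. *)
Lemma Lp_norm_interpolation p q r a f : 0 < p -> 0 < q -> 0 < r -> 0 <= a <= 1 ->
  r = a * p + (1 - a) * q ->
  Lp_norm r f <= Lp_norm p f `^ (a * p / r) * Lp_norm q f `^ (1 - a * p / r).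
Proof.
move=> p0 q0 r0 a01 rE.
have bE : 1 - a * p / r = (1 - a) * q / r.
  by rewrite -[X in X - _](mulfV (lt0r_neq0 r0)) -mulrBl {1}rE addrAC subrr add0r.
have powE s c : 0 < s -> (Lp_norm s f `^ (c * s / r)) `^ r
    = cube_mean (fun delta => normc (f delta) `^ s) `^ c.
  move=> s0; rewrite -(Lp_norm_powR f s0) -powRrM -powRrM.
  by rewrite (divfK (lt0r_neq0 r0)) mulrC.
apply: Lp_norm_leP; rewrite ?mulr_ge0 ?powR_ge0 // bE.
rewrite powRM; [|exact: powR_ge0..].
rewrite [X in _ <= X * _](powE p a p0) [X in _ <= _ * X](powE q (1 - a) q0).
have F0 s (delta : cube n) : 0 <= normc (f delta) `^ s by exact: powR_ge0.
have h := @cube_mean_holder R n (fun delta => normc (f delta) `^ p)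
  (fun delta => normc (f delta) `^ q) a (F0 p) (F0 q) a01.
refine (le_trans _ h) => {h}.
apply: cube_mean_le => delta; rewrite -(powRrM _ p) -(powRrM _ q).
by rewrite (mulrC p) (mulrC q) -powRD -?rE // gt_eqF.
Qed.

(** Minkowski's inequality by convexity of x^p: (|f| + |g|) / (a + b) is the convex combination of
    |f| / a and |g| / b with weight t = a / (a + b). Strictly positive bounds [a], [b] replace the
    norms themselves, which may be 0. *)
Lemma Lp_normD_le p f g a b : 1 <= p -> 0 < a -> 0 < b ->
  Lp_norm p f <= a -> Lp_norm p g <= b -> Lp_norm p (f + g) <= a + b.
Proof.
move=> p1 a0 b0 fa gb; have p0 : 0 < p by apply: lt_le_trans p1.
have ab0 : 0 < a + b by apply: addr_gt0.
have scaled (h : {ffun cube n -> R[i]}) (c : R) : 0 < c -> Lp_norm p h <= c ->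
    cube_mean (fun delta => (normc (h delta) / c) `^ p) <= 1.
  move=> c0 hc; rewrite (@eq_cube_mean _ _ _
      (fun delta => (c `^ p)^-1 * normc (h delta) `^ p)); last first.
    move=> delta; rewrite powRM ?normc_ge0 ?invr_ge0 ?(ltW c0) // mulrC.
    by rewrite -(powR_inv1 (ltW c0)) -(powRrM c) mulN1r powRN.
  rewrite cube_meanZ mulrC ler_pdivrMr ?powR_gt0 // mul1r.
  rewrite -(Lp_norm_powR h p0).
  by apply: ge0_ler_powR; rewrite ?nnegrE ?Lp_norm_ge0 ?(ltW p0) ?(ltW c0).
apply: Lp_norm_leP => //; first exact: ltW.
have [t tE] : exists t, t = a / (a + b) by exists (a / (a + b)).
have t01 : 0 <= t <= 1.
  by rewrite tE divr_ge0 ?(ltW a0) ?(ltW ab0) //= ler_pdivrMr // mul1r lerDl ltW.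
apply: le_trans (cube_mean_le (G := fun delta => (a + b) `^ p *
  (t * (normc (f delta) / a) `^ p + (1 - t) * (normc (g delta) / b) `^ p)) _) _.
  move=> delta.
  have x0 : 0 <= normc (f delta) / a by rewrite divr_ge0 ?normc_ge0 ?(ltW a0).
  have y0 : 0 <= normc (g delta) / b by rewrite divr_ge0 ?normc_ge0 ?(ltW b0).
  apply: le_trans (_ : ((a + b) * (t * (normc (f delta) / a)
      + (1 - t) * (normc (g delta) / b))) `^ p <= _); last first.
    rewrite powRM ?(ltW ab0) //; last first.
      by case/andP: t01 => t0 t1; apply: addr_ge0; apply: mulr_ge0; rewrite ?subr_ge0.
    by rewrite ler_wpM2l ?powR_ge0 // powR_convex.
  have -> : (a + b) * (t * (normc (f delta) / a) + (1 - t) * (normc (g delta) / b))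
      = normc (f delta) + normc (g delta).
    by rewrite tE; field; rewrite !gt_eqF.
  apply: ge0_ler_powR; rewrite ?nnegrE ?addr_ge0 ?normc_ge0 ?(ltW p0) //.
  by rewrite ffunE le_normcD.
rewrite cube_meanZ ler_piMr ?powR_ge0 // cube_meanD !cube_meanZ.
case/andP: t01 => t0 t1; rewrite [leRHS](_ : 1 = t * 1 + (1 - t) * 1); last by ring.
by apply: lerD; apply: ler_wpM2l; rewrite ?subr_ge0 ?scaled.
Qed.

Lemma Lp_normD p f g : 1 <= p -> Lp_norm p (f + g) <= Lp_norm p f + Lp_norm p g.
Proof.
move=> p1; apply/ler_addgt0Pr => e e0.
have -> (x y : R) : x + y + e = (x + e / 2) + (y + e / 2).
  by rewrite addrACA -splitr.
have e20 : 0 < e / 2 by rewrite divr_gt0.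
by apply: Lp_normD_le; rewrite ?ltr_wpDl ?Lp_norm_ge0 // lerDl ltW.
Qed.

Lemma Lp_normZ p (c : R[i]) f : 0 < p ->
  Lp_norm p [ffun delta => c * f delta] = normc c * Lp_norm p f.
Proof.
move=> p0; rewrite !Lp_normE.
rewrite (@eq_cube_mean _ _ _ (fun delta => normc c `^ p * normc (f delta) `^ p)).
  rewrite cube_meanZ powRM ?powR_ge0 ?mean_powR_ge0 // -powRrM mulfV ?gt_eqF //.
  by rewrite powRr1 ?normc_ge0.
by move=> delta; rewrite ffunE Normc.normcM powRM ?normc_ge0.
Qed.

Lemma Lp_norm_flip p j f : Lp_norm p [ffun delta => f (flip j delta)] = Lp_norm p f.
Proof.
rewrite !Lp_normE -[in RHS](cube_mean_flip j).
by congr (_ `^ _); apply: eq_cube_mean => delta; rewrite ffunE.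
Qed.

End LpNorm.

(** * The logarithmic series *)

Section LogSeries.
Variable R : realType.
Implicit Types y : R.

(* Partial sums of the expansion of y = -ln (1 - u) in powers of u = 1 - e^{-y}. *)
Definition log_partial (J : nat) y : R :=
  \sum_(j < J) (j.+1%:R)^-1 * (1 - expR (- y)) ^+ j.+1.

(* With u' = e^{-y} = 1 - u the derivative is (1 - u) (1 + u + ... + u^(J-1)). *)
Lemma is_derive_log_partial J y :
  is_derive y 1 (log_partial J) (1 - (1 - expR (- y)) ^+ J).
Proof.
elim: J => [|J IH].
  rewrite (_ : log_partial 0 = cst 0); last first.
    by apply/funext => z; rewrite /log_partial big_ord0.
  by rewrite expr0 subrr; exact: is_derive_cst.
have -> : log_partial J.+1
    = log_partial J + (J.+1%:R)^-1 \*: (fun z => 1 - expR (- z)) ^+ J.+1.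
  by apply/funext => z; rewrite !fctE /log_partial big_ord_recr.
have dexp : is_derive y 1 (fun z : R => 1 - expR (- z)) (expR (- y)).
  have h : is_derive y (1 : R) (fun z : R => expR (- z)) (- expR (- y)).
    have := @is_derive1_comp R expR (-%R) y _ _
      (is_derive_expR (- y)) (is_deriveNid y 1).
    by rewrite mulrN1.
  have := is_deriveB (is_derive_cst (1 : R) y 1) h.
  by rewrite sub0r opprK.
have := is_deriveD IH (is_deriveZ J.+1%:R^-1 (is_deriveX J.+1 dexp)).
move=> h; apply: (is_derive_eq h); rewrite /GRing.scale /= !mulrA mulVf ?pnatr_eq0 //.
rewrite mul1r exprS.
(* What remains is the telescoping identity 1 - u^J + u^J (1 - u) = 1 - u^(J+1). *)
set u := 1 - expR (- y); have -> : expR (- y) = 1 - u by rewrite /u subKr.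
ring.
Qed.

(** The remainder y - [log_partial J y] vanishes at 0 and has derivative (1 - e^(-z))^J, so the mean
    value theorem bounds it by y u^J with u = 1 - e^(-y) < 1. *)
Lemma log_partial_cvg y : 0 <= y -> log_partial J y @[J --> \oo] --> y.
Proof.
rewrite le_eqVlt => /predU1P[<-|y0].
  have -> : log_partial^~ 0 = fun=> 0 :> R.
    apply/funext => J; rewrite /log_partial big1 // => i _.
    by rewrite oppr0 expR0 subrr exprS mul0r mulr0.
  exact: cvg_cst.
set u := 1 - expR (- y).
have u01 : `|u| < 1.
  rewrite ger0_norm ?subr_ge0 ?expR_le1 ?oppr_le0 ?ltW //.
  by rewrite ltrBlDr ltrDl expR_gt0.
have u0 : 0 <= u by rewrite subr_ge0 expR_le1 oppr_le0 ltW.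
have bound J : `|y - log_partial J y| <= y * u ^+ J.
  have df z : z \in `]0, y[%R -> is_derive z 1 (id - log_partial J)
      (1 - (1 - (1 - expR (- z)) ^+ J)).
    by move=> _; have lp := is_derive_log_partial J z; exact: is_deriveB.
  have cf : {within `[0, y], continuous (id - log_partial J)}.
    apply: derivable_within_continuous => z _.
    apply: derivableB; first exact: derivable_id.
    by apply: ex_derive; exact: is_derive_log_partial.
  have [c /[!in_itv] /= /andP[c0 cy]] := MVT y0 df cf.
  have -> : (id - log_partial J) 0 = 0.
    rewrite /= /log_partial !fctE big1 ?subrr // => i _.
    by rewrite oppr0 expR0 subrr exprS mul0r mulr0.
  rewrite !subr0 subKr => yE; rewrite [X in `|X|]yE.
  have v0 : 0 <= 1 - expR (- c) by rewrite subr_ge0 expR_le1 oppr_le0 ltW.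
  rewrite ger0_norm ?mulr_ge0 ?exprn_ge0 ?(ltW y0) // mulrC ler_wpM2l ?(ltW y0) //.
  by apply: lerXn2r; rewrite ?nnegrE // lerB // ler_expR lerN2 ltW.
have yu : y * u ^+ J @[J --> \oo] --> (0 : R).
  by rewrite -(mulr0 y); apply: cvgMr; exact: cvg_expr.
apply/cvgrPdist_le => e e0.
have /cvgrPdist_le /(_ e e0) := yu.
apply: filterS => J; rewrite sub0r normrN => h.
apply: le_trans (bound J) _; apply: le_trans h; exact: ler_norm.
Qed.

End LogSeries.

(** * Fourier multipliers *)

Section Multipliers.
Variables (R : realType) (n : nat).
Implicit Types (c : {set 'I_n} -> R[i]) (m : {set 'I_n} -> R) (p q : R).
Local Notation normc := Normc.normc.

Definition multiplier m c : {set 'I_n} -> R[i] := fun S => (m S)%:C * c S.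

Lemma eq_walsh_sum c c' : c =1 c' -> walsh_sum c = walsh_sum c'.
Proof.
by move=> cc; apply/ffunP => delta; rewrite !ffunE; apply: eq_bigr => S _; rewrite cc.
Qed.

Lemma walsh_sumD c c' :
  walsh_sum (fun S => c S + c' S) = walsh_sum c + walsh_sum c'.
Proof.
apply/ffunP => delta; rewrite !ffunE -big_split /=.
by apply: eq_bigr => S _; rewrite mulrDl.
Qed.

Lemma walsh_sumZ (z : R[i]) c :
  walsh_sum (fun S => z * c S) = [ffun delta => z * walsh_sum c delta].
Proof.
apply/ffunP => delta; rewrite !ffunE mulr_sumr.
by apply: eq_bigr => S _; rewrite mulrA.
Qed.

(** A crude bound from |w_S| = 1, applied only where the right-hand side is zero or tends to
    zero. *)
Lemma Lp_norm_walsh_sum_le p c : 0 < p ->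
  Lp_norm p (walsh_sum c) <= \sum_S normc (c S).
Proof.
move=> p0; have s0 : 0 <= \sum_S normc (c S).
  by apply: sumr_ge0 => S _; exact: normc_ge0.
apply: Lp_norm_leP => //; rewrite -[leRHS](cube_mean_cst n).
apply: cube_mean_le => delta.
apply: ge0_ler_powR; rewrite ?nnegrE ?normc_ge0 ?(ltW p0) //.
rewrite ffunE; apply: (big_ind2 (fun (z : R[i]) (x : R) => normc z <= x))
    => [|z x w y zx wy|S _].
- by rewrite Normc.normc0.
- by apply: le_trans (le_normcD _ _) _; exact: lerD.
- by rewrite Normc.normcM normc_walsh mulr1.
Qed.

Lemma Lp_norm_multiplierD p m m' c : 1 <= p ->
  Lp_norm p (walsh_sum (multiplier (fun S => m S + m' S) c))
    <= Lp_norm p (walsh_sum (multiplier m c))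
       + Lp_norm p (walsh_sum (multiplier m' c)).
Proof.
move=> p1; rewrite (@eq_walsh_sum _ (fun S => multiplier m c S + multiplier m' c S)).
  by rewrite walsh_sumD Lp_normD.
by move=> S; rewrite /multiplier rmorphD mulrDl.
Qed.

Lemma Lp_norm_multiplierZ p (a : R) m c : 0 < p ->
  Lp_norm p (walsh_sum (multiplier (fun S => a * m S) c))
    = `|a| * Lp_norm p (walsh_sum (multiplier m c)).
Proof.
move=> p0; rewrite (@eq_walsh_sum _ (fun S => a%:C * multiplier m c S)).
  by rewrite walsh_sumZ Lp_normZ // normc_real.
by move=> S; rewrite /multiplier rmorphM mulrA.
Qed.

Lemma Lp_norm_multiplier_sum p (J : nat) (b : nat -> R)
    (m : nat -> {set 'I_n} -> R) c :
  1 <= p ->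
  Lp_norm p (walsh_sum (multiplier (fun S => \sum_(j < J) b j * m j S) c))
    <= \sum_(j < J) `|b j| * Lp_norm p (walsh_sum (multiplier (m j) c)).
Proof.
move=> p1; have p0 : 0 < p by apply: lt_le_trans p1.
elim: J => [|J IH].
  rewrite big_ord0; apply: le_trans (Lp_norm_walsh_sum_le _ p0) _.
  by rewrite big1 // => S _; rewrite /multiplier big_ord0 mul0r Normc.normc0.
rewrite big_ord_recr /= (@eq_walsh_sum _ (multiplier
    (fun S => (\sum_(j < J) b j * m j S) + b J * m J S) c)); last first.
  by move=> S; rewrite /multiplier big_ord_recr.
apply: le_trans (Lp_norm_multiplierD _ _ _ p1) _.
by rewrite Lp_norm_multiplierZ // lerD2r.
Qed.

(** For fixed [n] there are finitely many [S], so coefficientwise convergence already gives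
    convergence in norm, and bounds pass to the limit. This is how both infinite series, logarithmic
    and exponential, are summed. *)
Lemma Lp_norm_multiplier_cvg p (m : nat -> {set 'I_n} -> R)
    (m_lim : {set 'I_n} -> R) (B : nat -> R) (b : R) c : 1 <= p ->
  (forall S, m J S @[J --> \oo] --> m_lim S) -> B J @[J --> \oo] --> b ->
  (forall J, Lp_norm p (walsh_sum (multiplier (m J) c)) <= B J) ->
  Lp_norm p (walsh_sum (multiplier m_lim c)) <= b.
Proof.
move=> p1 mcvg Bcvg mB; have p0 : 0 < p by apply: lt_le_trans p1.
have rcvg : \sum_S `|m_lim S - m J S| * normc (c S) @[J --> \oo] --> (0 : R).
  rewrite [X in _ --> X](_ : _ = \sum_(S : {set 'I_n}) 0); last by rewrite big1.
  apply: cvg_big => [|S _]; first exact: add_continuous.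
  rewrite -(mul0r (normc (c S))); apply: cvgMl.
  rewrite -(normr0 R) -(subrr (m_lim S)); apply: cvg_norm.
  by apply: cvgB => //; exact: cvg_cst.
rewrite -(addr0 b); apply: (cvgr_to_ge (cvgD Bcvg rcvg)).
apply: nearW => J /=.
rewrite (@eq_walsh_sum _ (multiplier (fun S => m J S + (m_lim S - m J S)) c)).
  apply: le_trans (Lp_norm_multiplierD _ _ _ p1) _; apply: lerD => //.
  apply: le_trans (Lp_norm_walsh_sum_le _ p0) _.
  by apply: ler_sum => S _; rewrite /multiplier Normc.normcM normc_real.
by move=> S; rewrite /multiplier addrC subrK.
Qed.

(** The symbol rho^|S| is the noise operator, with rho = e^(-h) for the heat semigroup. It is a
    composition over the coordinates of averages of the identity and a flip, and flips preserve the
    norm. *)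
Lemma Lp_norm_multiplier_contraction q (rho : R) c : 1 <= q -> 0 <= rho <= 1 ->
  Lp_norm q (walsh_sum (multiplier (fun S => rho ^+ #|S|) c))
    <= Lp_norm q (walsh_sum c).
Proof.
move=> q1 /andP[r0 r1]; have q0 : 0 < q by apply: lt_le_trans q1.
(* Induction on the list [s] of coordinates already averaged; the exponent counts those lying in
   [S]. *)
have key (s : seq 'I_n) : Lp_norm q (walsh_sum
    (multiplier (fun S : {set 'I_n} => rho ^+ count (mem S) s) c))
      <= Lp_norm q (walsh_sum c).
  elim: s => [|j s IH].
    rewrite (@eq_walsh_sum _ c) // => S.
    by rewrite /multiplier /= expr0 mul1r.
  apply: le_trans IH.
  set c' := multiplier (fun S : {set 'I_n} => rho ^+ count (mem S) s) c.
  set f := walsh_sum c'.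
  (* On w_S the average acts by (1 + rho)/2 + (1 - rho)/2 = 1 if [j] is outside [S], and by (1 +
     rho)/2 - (1 - rho)/2 = rho if [j] is in [S]. *)
  have -> : walsh_sum (multiplier
        (fun S : {set 'I_n} => rho ^+ count (mem S) (j :: s)) c)
      = [ffun delta => ((1 + rho) / 2)%:C * f delta]
        + [ffun delta => ((1 - rho) / 2)%:C *
            [ffun delta' => f (flip j delta')] delta].
    apply/ffunP => delta; rewrite !ffunE !mulr_sumr -big_split /=.
    apply: eq_bigr => S _; rewrite walsh_flip /c' /multiplier /=.
    case: (j \in S); rewrite /= ?expr0 ?expr1 ?exprS ?add1n ?add0n ?exprS;
      rewrite !(rmorphM, rmorphD, rmorphB, rmorph1, fmorphV, rmorph_nat) /=;
      by field.
  apply: le_trans (Lp_normD _ _ q1) _; rewrite !Lp_normZ // Lp_norm_flip !normc_real.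
  rewrite !ger0_norm ?divr_ge0 ?subr_ge0 ?addr_ge0 // -mulrDl.
  by rewrite [X in X * _](_ : _ = 1) ?mul1r //; field.
rewrite (@eq_walsh_sum _ (multiplier
  (fun S => rho ^+ count (mem S) (enum 'I_n)) c)) // => S.
by rewrite /multiplier -size_filter cardE enumT.
Qed.

End Multipliers.

(** * Parseval's identity and multipliers on L^2 *)

Section Parseval.
Variables (R : realType) (n : nat).
Implicit Types (c : {set 'I_n} -> R[i]) (m : {set 'I_n} -> R) (a : R).
Local Notation normc := Normc.normc.

Lemma walsh_conj S (delta : cube n) : Num.conj (walsh R S delta) = walsh R S delta.
Proof.
rewrite /walsh rmorph_prod; apply: eq_bigr => j _.
by rewrite /Defs.coord rmorphXn rmorphN1.
Qed.

Lemma parseval c :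
  Lp_norm 2 (walsh_sum c) ^+ 2 = \sum_S normc (c S) ^+ 2.
Proof.
rewrite -powR_mulrn ?Lp_norm_ge0 // Lp_norm_powR //.
apply: complexI; rewrite /cube_mean rmorphM rmorph_sum [RHS]rmorph_sum /=.
under eq_bigr => delta _.
  rewrite powR_mulrn ?normc_ge0 // normc_sqr.
  rewrite -[X in _ * Num.conj X](_ : \sum_S c S * walsh R S delta = _) ?ffunE //.
  rewrite rmorph_sum mulr_sumr.
  under eq_bigr => S _ do rewrite rmorphM /= walsh_conj mulrCA.
  over.
rewrite exchange_big mulr_sumr; apply: eq_bigr => S _ /=.
rewrite normc_sqr -mulr_sumr mulrCA mulrC; congr (_ * _).
rewrite -[RHS](fourier_walsh_sum c S) /fourier_walsh fmorphV rmorphXn rmorph_nat.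
by congr (_ * _); apply: eq_bigr => delta _; rewrite ffunE.
Qed.

(** By Parseval only the support of [c] matters; restricting the bound on [m] to it is what lets the
    degree of the function enter. *)
Lemma L2_norm_multiplier_le m c a : 0 <= a ->
  (forall S, c S != 0 -> `|m S| <= a) ->
  Lp_norm 2 (walsh_sum (multiplier m c)) <= a * Lp_norm 2 (walsh_sum c).
Proof.
move=> a0 ma; have sqr_le (x y : R) : 0 <= x -> 0 <= y -> x ^+ 2 <= y ^+ 2 -> x <= y.
  by move=> x0 y0; rewrite ler_pXn2r // nnegrE.
refine (sqr_le _ _ (Lp_norm_ge0 _ _) (mulr_ge0 a0 (Lp_norm_ge0 _ _)) _).
rewrite parseval [X in _ <= X]exprMn parseval mulr_sumr; apply: ler_sum => S _.
rewrite /multiplier Normc.normcM exprMn normc_real.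
have [->|cS] := eqVneq (c S) 0; first by rewrite Normc.normc0 expr0n !mulr0.
by rewrite ler_wpM2r ?sqr_ge0 // lerXn2r ?nnegrE // ma.
Qed.

End Parseval.

(** * Powers of u = 1 - e^(-h Delta) *)

Section Differences.
Variables (R : realType) (n : nat).
Implicit Types (c : {set 'I_n} -> R[i]) (p q h eta theta : R).

(** The eigenvalue of u = 1 - e^(-h Delta) on w_S. *)
Definition heat_diff (h : R) (S : {set 'I_n}) : R := 1 - expR (- (h * #|S|%:R)).

Lemma heat_diff_ge0 h S : 0 <= h -> 0 <= heat_diff h S.
Proof. by move=> h0; rewrite subr_ge0 expR_le1 oppr_le0 mulr_ge0. Qed.

Lemma heat_diff_le h S : heat_diff h S <= h * #|S|%:R.
Proof. by have := expR_ge1Dx (- (h * #|S|%:R)); rewrite /heat_diff; lra. Qed.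

Lemma Lp_norm_heat_diff q h m c : 1 <= q -> 0 <= h ->
  Lp_norm q (walsh_sum (multiplier (fun S => heat_diff h S ^+ m) c))
    <= 2 ^+ m * Lp_norm q (walsh_sum c).
Proof.
move=> q1 h0; have q0 : 0 < q by apply: lt_le_trans q1.
elim: m => [|m IH].
  by rewrite mul1r (@eq_walsh_sum _ _ _ c) // => S; rewrite /multiplier mul1r.
rewrite exprS -mulrA; apply: le_trans (ler_wpM2l (ler0n _ 2) IH).
pose c' := multiplier (fun S => heat_diff h S ^+ m) c.
(* Writing u^(m+1) = u^m - e^(-h Delta) u^m, the contraction property makes each step cost a factor
   at most 2. *)
rewrite (@eq_walsh_sum _ _ _ (multiplier (fun S => heat_diff h S ^+ m
    + (-1) * (expR (- h) ^+ #|S| * heat_diff h S ^+ m)) c)); last first.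
  move=> S; rewrite /multiplier exprS {1}/heat_diff -mulNr expRM_natr.
  by rewrite mulrBl mul1r mulN1r.
apply: le_trans (Lp_norm_multiplierD _ _ _ q1) _.
rewrite [X in _ + X <= _](Lp_norm_multiplierZ _ _ _ q0) normrN1 [X in _ + X <= _]mul1r.
rewrite [leRHS]mulr_natl [leRHS]mulr2n lerD2l.
rewrite (@eq_walsh_sum _ _ _ (multiplier (fun S => expR (- h) ^+ #|S|) c')); last first.
  by move=> S; rewrite /c' /multiplier rmorphM mulrA.
by apply: Lp_norm_multiplier_contraction => //; rewrite expR_ge0 expR_le1 oppr_le0.
Qed.

Lemma L2_norm_heat_diff h (d m : nat) c : 0 <= h ->
  (forall S : {set 'I_n}, (d < #|S|)%N -> c S = 0) ->
  Lp_norm 2 (walsh_sum (multiplier (fun S => heat_diff h S ^+ m) c))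
    <= (h * d%:R) ^+ m * Lp_norm 2 (walsh_sum c).
Proof.
move=> h0 cd; apply: L2_norm_multiplier_le => [|S cS].
  by rewrite exprn_ge0 // mulr_ge0.
rewrite ger0_norm ?exprn_ge0 ?heat_diff_ge0 //.
rewrite lerXn2r ?nnegrE ?heat_diff_ge0 ?mulr_ge0 //.
apply: le_trans (heat_diff_le h S) _; rewrite ler_wpM2l // ler_nat leqNgt.
by apply: contra_neqN cS => /cd.
Qed.

(** Interpolating the L^2 bound (h d)^m and the L^q bound 2^m with weight theta = 2 a / p gives ((h
    d)^theta 2^(1 - theta))^m, where the base is at most 1/4 * 2 = 1/2. The L^2 norm of the function
    itself is absorbed in its L^q norm, as 2 <= q. *)
Lemma Lp_norm_heat_diff_interpolated p q a h (d m : nat) c :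
  2 <= p -> p < q -> 0 < a <= 1 -> p = a * 2 + (1 - a) * q -> 0 <= h ->
  (h * d%:R) `^ (a * 2 / p) <= 4^-1 ->
  (forall S : {set 'I_n}, (d < #|S|)%N -> c S = 0) ->
  Lp_norm p (walsh_sum (multiplier (fun S => heat_diff h S ^+ m) c))
    <= 2^-1 ^+ m * Lp_norm q (walsh_sum c).
Proof.
move=> p2 pq /andP[a0 a1] pE h0 hd cd.
have p0 : 0 < p by apply: lt_le_trans p2.
have q0 : 0 < q by apply: lt_trans pq.
set theta := a * 2 / p in hd *.
have t0 : 0 <= theta by rewrite divr_ge0 ?mulr_ge0 // ltW.
have t1 : theta <= 1.
  rewrite ler_pdivrMr // mul1r [leRHS]pE lerDl mulr_ge0 ?subr_ge0 // ltW //.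
set F := Lp_norm q (walsh_sum c).
have F0 : 0 <= F by exact: Lp_norm_ge0.
have eta0 : 0 <= h * d%:R by rewrite mulr_ge0.
apply: le_trans (@Lp_norm_interpolation R n 2 q p a _ _ _ _ _ pE) _ => //.
  by rewrite ltW.
rewrite -/theta.
have L2 : Lp_norm 2 (walsh_sum (multiplier (fun S => heat_diff h S ^+ m) c))
    <= (h * d%:R) ^+ m * F.
  apply: le_trans (L2_norm_heat_diff m h0 cd) _; rewrite ler_wpM2l ?exprn_ge0 //.
  by apply: Lp_norm_mono; rewrite ltr0n /= (le_trans p2) // ltW.
have weighted (x y z w : R) : 0 <= x <= z -> 0 <= y <= w ->
    x `^ theta * y `^ (1 - theta) <= z `^ theta * w `^ (1 - theta).
  move=> /andP[x0 xz] /andP[y0 yw]; apply: ler_pM; rewrite ?powR_ge0 //.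
    by apply: ge0_ler_powR => //; rewrite nnegrE // (le_trans x0).
  by apply: ge0_ler_powR; rewrite ?subr_ge0 ?nnegrE // (le_trans y0).
have q1 : 1 <= q by rewrite (le_trans _ (ltW pq)) // (le_trans _ p2) // ler1n.
apply: le_trans (weighted _ _ ((h * d%:R) ^+ m * F) (2 ^+ m * F) _ _) _.
- by rewrite Lp_norm_ge0.
- by rewrite Lp_norm_ge0 (Lp_norm_heat_diff m c q1 h0).
clearbody F => {L2 weighted}.
rewrite !powRM ?exprn_ge0 // mulrACA -powRD; last by rewrite addrC subrK oner_eq0.
rewrite [theta + _]addrC subrK powRr1 // ler_wpM2r //.
rewrite -!powR_mulrn // [_ `^ theta]powRAC [_ `^ (1 - theta)]powRAC -powRM ?powR_ge0 //.
apply: ge0_ler_powR; rewrite ?nnegrE ?mulr_ge0 ?powR_ge0 ?invr_ge0 //.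
have -> : 2^-1 = 4^-1 * 2 :> R by field.
apply: ler_pM; rewrite ?powR_ge0 //.
by rewrite ler1_powR ?ler1n // gerBl.
Qed.

End Differences.

(** * The Bernstein-Markov inequality and the heat semigroup *)

Section Bernstein.
Variables (R : realType) (n : nat).
Implicit Types (c : {set 'I_n} -> R[i]) (p q h : R).

Lemma sum_half_le1 (J : nat) : \sum_(j < J) 2^-1 ^+ j.+1 <= 1 :> R.
Proof.
suff -> : \sum_(j < J) 2^-1 ^+ j.+1 = 1 - 2^-1 ^+ J :> R.
  by rewrite gerBl exprn_ge0 // invr_ge0.
elim: J => [|J IH]; first by rewrite big_ord0 subrr.
by rewrite big_ord_recr /= IH exprS; field.
Qed.

(** Induction on [k] for all [m] at once. Expanding one factor h|S| as the sum of u^j / j over j >=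
    1 reduces [k.+1] at [m] to [k] at every m + j; each extra u^j contributes 2^-j, and these sum to
    at most 1, so a step in [k] costs exactly 1/h. *)
Lemma Lp_norm_laplacian_heat_diff p h (F : R) c : 1 <= p -> 0 < h -> 0 <= F ->
  (forall m, Lp_norm p (walsh_sum (multiplier (fun S => heat_diff h S ^+ m) c))
    <= 2^-1 ^+ m * F) ->
  forall k m, Lp_norm p
      (walsh_sum (multiplier (fun S => heat_diff h S ^+ m * #|S|%:R ^+ k) c))
    <= h^-1 ^+ k * (2^-1 ^+ m * F).
Proof.
move=> p1 h0 F0 base; have hV0 : 0 <= h^-1 by rewrite invr_ge0 ltW.
have half0 : 0 <= 2^-1 :> R by rewrite invr_ge0.
elim=> [|k IH] m.
  rewrite expr0 mul1r; apply: le_trans (base m).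
  by rewrite (@eq_walsh_sum _ _ _ (multiplier (fun S => heat_diff h S ^+ m) c))
    // => S;
    rewrite /multiplier mulr1.
(* Truncations of the series for u^m |S|^(k+1) obtained from the logarithmic expansion of h|S|; the
   bound proved for them does not depend on [J]. *)
pose a (J : nat) (S : {set 'I_n}) : R :=
  \sum_(j < J) (h^-1 * j.+1%:R^-1) * (heat_diff h S ^+ (m + j.+1) * #|S|%:R ^+ k).
apply: (@Lp_norm_multiplier_cvg R n p a _
    (fun=> h^-1 ^+ k.+1 * (2^-1 ^+ m * F)) _ c p1); last 2 first.
- exact: cvg_cst.
- move=> J; apply: le_trans (Lp_norm_multiplier_sum J (fun j => h^-1 * j.+1%:R^-1)
    (fun j S => heat_diff h S ^+ (m + j.+1) * #|S|%:R ^+ k) c p1) _.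
  set K := h^-1 ^+ k.+1 * (2^-1 ^+ m * F).
  have K0 : 0 <= K by rewrite !mulr_ge0 ?exprn_ge0.
  apply: le_trans (_ : \sum_(j < J) K * 2^-1 ^+ j.+1 <= _); last first.
    by rewrite -mulr_sumr -[leRHS]mulr1 ler_wpM2l // sum_half_le1.
  apply: ler_sum => j _.
  (* The induction hypothesis at [m + j.+1], with 1/(j+1) estimated by 1. *)
  apply: le_trans (_ : h^-1 * (h^-1 ^+ k * (2^-1 ^+ (m + j.+1) * F)) <= _).
    apply: ler_pM; rewrite ?Lp_norm_ge0 ?normr_ge0 //.
    rewrite ger0_norm ?mulr_ge0 ?invr_ge0 ?ler0n ?(ltW h0) //.
    by rewrite ler_piMr // invf_le1 ?ltr0n // ler1n.
  by rewrite /K exprD !exprS le_eqVlt; apply/orP; left; apply/eqP; ring.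
move=> S.
have -> : heat_diff h S ^+ m * #|S|%:R ^+ k.+1
    = h^-1 * heat_diff h S ^+ m * #|S|%:R ^+ k * (h * #|S|%:R).
  by rewrite exprS; field; rewrite gt_eqF.
have -> : a ^~ S = fun J => h^-1 * heat_diff h S ^+ m * #|S|%:R ^+ k
    * log_partial J (h * #|S|%:R).
  apply/funext => J; rewrite /a /log_partial mulr_sumr; apply: eq_bigr => j _.
  by rewrite exprD /heat_diff; ring.
by apply: cvgMr; apply: log_partial_cvg; rewrite mulr_ge0 // ltW.
Qed.

End Bernstein.

(** * Existence of the constant and its transfer to the heat semigroup *)

Section Main.
Variable R : realType.
Implicit Types p eps C : R.

Lemma bernstein_markov_exists p eps : 2 <= p -> 0 < eps ->
  exists C : R, bernstein_markov_constant p eps C.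
Proof.
move=> p2 e0; have p0 : 0 < p by apply: lt_le_trans p2.
have p1 : 1 <= p by apply: le_trans p2; rewrite ler1n.
pose q := p + eps; have pq : p < q by rewrite ltrDl.
have den : 0 < p + eps - 2 by lra.
(* The solution of p = 2 a + (1 - a) q; it is positive because eps > 0 and at most 1 because p >=
   2. *)
pose a := eps / (p + eps - 2).
have a01 : 0 < a <= 1 by rewrite divr_gt0 //= ler_pdivrMr // mul1r; lra.
have pE : p = a * 2 + (1 - a) * q by rewrite /a /q; field; rewrite gt_eqF.
pose theta := a * 2 / p.
have t0 : 0 < theta by case/andP: a01 => a0 _; rewrite divr_gt0 // mulr_gt0.
(* Chosen so that eta^theta = 1/4, hence depending only on [p] and [eps]. *)
pose eta : R := 4^-1 `^ theta^-1.
have eta0 : 0 < eta by rewrite powR_gt0 // invr_gt0.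
exists eta^-1 => n d f k n0 /andP[d0 dn] fd.
(* The time scale is inversely proportional to the degree, so that h d = eta and h^-k = eta^-k
   d^k. *)
pose h := eta / d%:R; have h0 : 0 < h by rewrite divr_gt0 // ltr0n.
have hd : h * d%:R = eta by rewrite divfK // pnatr_eq0 -lt0n.
have -> : eta^-1 ^+ k * d%:R ^+ k = h^-1 ^+ k by rewrite -exprMn invf_div mulrC.
have base m := @Lp_norm_heat_diff_interpolated R n p q a h d m (fourier_walsh f)
  p2 pq a01 pE (ltW h0).
have {}base m : Lp_norm p (walsh_sum
    (multiplier (fun S => heat_diff h S ^+ m) (fourier_walsh f)))
    <= 2^-1 ^+ m * Lp_norm q f.
  rewrite -[X in Lp_norm q X]walsh_inversion; apply: base fd.
  by rewrite hd -powRrM mulVf ?gt_eqF // powRr1 // invr_ge0.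
(* Only the case m = 0 is wanted in the end; larger [m] served the induction. *)
have := Lp_norm_laplacian_heat_diff p1 h0 (Lp_norm_ge0 _ _) base k 0.
rewrite expr0 mul1r -[X in iter k _ X]walsh_inversion iter_laplacian_walsh_sum.
by rewrite (@eq_walsh_sum _ _ _
  (fun S => (#|S|%:R ^+ k)%:C * fourier_walsh f S)) // => S;
  rewrite /multiplier mul1r.
Qed.

(** The function g = e^(-t Delta) f still has degree at most [d], so the inequality bounds each term
    of f = e^(t Delta) g. The resulting bounds (C t d)^j / j! sum to e^(C t d), so the constant is
    preserved. *)
Lemma heat_lower_of_bernstein_markov p eps C : 1 <= p ->
  bernstein_markov_constant p eps C -> heat_lower_constant p eps C.
Proof.
move=> p1 BM n d f t n0 dn fd t0.
set g := heat t f.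
pose c' := multiplier (fun S : {set 'I_n} => expR (- t * #|S|%:R)) (fourier_walsh f).
have gE : g = walsh_sum c' by exact: heatE.
have gd : Deg_le d g.
  by move=> S dS; rewrite gE fourier_walsh_sum /c' /multiplier fd // mulr0.
have fE : f = walsh_sum (multiplier (fun S : {set 'I_n} => expR (t * #|S|%:R)) c').
  rewrite -[LHS]walsh_inversion; apply: eq_walsh_sum => S.
  by rewrite /c' /multiplier mulrA -rmorphM /= -expRD mulNr subrr expR0 mul1r.
suff H : Lp_norm p f <= expR (C * t * d%:R) * Lp_norm (p + eps) g.
  by rewrite !mulNr expRN mulrC ler_pdivrMr ?expR_gt0 // mulrC.
rewrite fE.
(* Both sides are approximated by exponential partial sums: the symbol e^(t|S|) on the left and the
   scalar e^(C t d) on the right. *)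
apply: (@Lp_norm_multiplier_cvg R n p
  (fun J S => \sum_(j < J) (t ^+ j / j`!%:R) * #|S|%:R ^+ j) _
  (fun J => series (exp_coeff (C * t * d%:R)) J * Lp_norm (p + eps) g) _ c' p1).
- move=> S; rewrite (_ : (fun J => _) = series (exp_coeff (t * #|S|%:R))).
    exact: is_cvg_series_exp_coeff.
  apply/funext => J; rewrite /series /= big_mkord; apply: eq_bigr => j _.
  by rewrite /exp_coeff /= exprMn mulrAC.
- by apply: cvgMl; exact: is_cvg_series_exp_coeff.
move=> J; apply: le_trans (Lp_norm_multiplier_sum J (fun j => t ^+ j / j`!%:R)
  (fun j S => #|S|%:R ^+ j) c' p1) _.
rewrite /series /= big_mkord mulr_suml; apply: ler_sum => j _.
have w0 : 0 <= t ^+ j / j`!%:R by rewrite divr_ge0 ?exprn_ge0 ?(ltW t0).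
rewrite [X in X * _ <= _](ger0_norm w0).
(* The multiplier |S|^j applied to the coefficients of [g] is Delta^j g, to which [BM] applies. *)
apply: le_trans (ler_wpM2l w0 (_ : _ <= C ^+ j * d%:R ^+ j * Lp_norm (p + eps) g)) _.
  by rewrite -iter_laplacian_walsh_sum -gE; exact: BM n0 dn gd.
move: (Lp_norm _ g) => G; rewrite /exp_coeff /= !exprMn le_eqVlt.
by apply/orP; left; apply/eqP; ring.
Qed.

End Main.

Theorem corollary1p4 (R : realType) (p eps : R) (hp : 2 <= p) (heps : 0 < eps) :
  (exists C : R, heat_lower_constant p eps C) /\
  (exists C : R, bernstein_markov_constant p eps C) /\
  (forall C : R, bernstein_markov_constant p eps C ->
     heat_lower_constant p eps C).
Proof.
have p1 : 1 <= p by apply: le_trans hp; rewrite ler1n.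
have [C BM] := bernstein_markov_exists hp heps.
split; first by exists C; exact: heat_lower_of_bernstein_markov.
by split; [exists C|move=> C'; exact: heat_lower_of_bernstein_markov].
Qed.
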